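(* For every triangle, the following bounds hold, where a bound $L\le \frac{D(n,i)}{D(n,j)}\le U$ means $L\,D(n,j)\le D(n,i)\le U\,D(n,j)$ (and similarly for one-sided bounds and equalities): $$\frac{D(2,1)}{D(2,3)}\le2,\quad \frac{D(2,1)}{D(2,4)}\le1,\quad \frac{D(2,1)}{D(2,5)}\le4,\quad 6\sqrt2-8\le\frac{D(2,1)}{D(2,6)}\le1,\quad \frac14\le\frac{D(2,1)}{D(2,7)}\le1,$$ $$\frac{D(2,1)}{D(2,8)}=\frac12,\quad \frac12\le\frac{D(2,1)}{D(2,9)}\le2,\quad \frac{D(2,1)}{D(2,10)}=2,$$ $$\frac{D(2,3)}{D(2,4)}=\frac12,\quad \frac{D(2,3)}{D(2,5)}=2,\quad \frac12\le\frac{D(2,3)}{D(2,6)},\quad \frac12\le\frac{D(2,3)}{D(2,7)},\quad \frac14\le\frac{D(2,3)}{D(2,8)},\quad 1\le\frac{D(2,3)}{D(2,9)},\quad 1\le\frac{D(2,3)}{D(2,10)},$$ $$\frac{D(2,4)}{D(2,5)}=4,\quad 1\le\frac{D(2,4)}{D(2,6)},\quad 1\le\frac{D(2,4)}{D(2,7)},\quad \frac12\le\frac{D(2,4)}{D(2,8)},\quad 2\le\frac{D(2,4)}{D(2,9)},\quad 2\le\frac{D(2,4)}{D(2,10)},$$ $$\frac14\le\frac{D(2,5)}{D(2,6)},\quad \frac14\le\frac{D(2,5)}{D(2,7)},\quad \frac18\le\frac{D(2,5)}{D(2,8)},\quad \frac12\le\frac{D(2,5)}{D(2,9)},\quad \frac12\le\frac{D(2,5)}{D(2,10)},$$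 $$\frac12\le\frac{D(2,6)}{D(2,7)}\le\frac32,\quad \frac12\le\frac{D(2,6)}{D(2,8)}\le\frac{4+3\sqrt2}{8},\quad 1\le\frac{D(2,6)}{D(2,9)}\le3,\quad 2\le\frac{D(2,6)}{D(2,10)}\le2+\frac3{\sqrt2},$$ $$\frac12\le\frac{D(2,7)}{D(2,8)}\le2,\quad \frac{D(2,7)}{D(2,9)}=2,\quad 2\le\frac{D(2,7)}{D(2,10)}\le8,\quad 1\le\frac{D(2,8)}{D(2,9)}\le4,\quad \frac{D(2,8)}{D(2,10)}=4,\quad 1\le\frac{D(2,9)}{D(2,10)}\le4.$$
   Context: For a (nondegenerate) triangle $ABC$ with side lengths $a=BC$, $b=CA$, $c=AB$, a point with barycentric coordinates $(u:v:w)$ is $(uA+vB+wC)/(u+v+w)$. For $1\le n\le 10$ the triangle center $X_n$ is the point with barycentric coordinates $(f_n(a,b,c):f_n(b,c,a):f_n(c,a,b))$, where $f_1=a$ (incenter); $f_2=1$ (centroid); $f_3=a^2(a^2-b^2-c^2)$ (circumcenter); $f_4=(a^2+b^2-c^2)(a^2-b^2+c^2)$ (orthocenter); $f_5=c^4-a^2b^2+b^4-a^2c^2-2b^2c^2$ (nine-point center); $f_6=a^2$ (symmedian point); $f_7=(a+b-c)(a-b+c)$ (Gergonne point); $f_8=a-b-c$ (Nagel point); $f_9=a(a-b-c)$ (mittenpunkt); $f_{10}=b+c$ (Spieker center). $D(i,j)$ denotes the Euclidean distance between $X_i$ and $X_j$. *)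

(* Defs.v *)
From Stdlib Require Import Reals.
Open Scope R_scope.

Definition point : Type := (R * R)%type.

Definition pdist (P Q : point) : R := dist_euc (fst P) (snd P) (fst Q) (snd Q).

(** The three points lie on a common line [p x + q y = r]. *)
Definition collinear (A B C : point) : Prop :=
  exists p q r : R,
    (p <> 0 \/ q <> 0) /\
    p * fst A + q * snd A = r /\
    p * fst B + q * snd B = r /\
    p * fst C + q * snd C = r.

Definition nondegenerate (A B C : point) : Prop := ~ collinear A B C.

(** Only meaningful when [u + v + w <> 0], which holds for all the centers
    below in a nondegenerate triangle. *)
Definition barycentric (A B C : point) (u v w : R) : point :=
  ((u * fst A + v * fst B + w * fst C) / (u + v + w),
   (u * snd A + v * snd B + w * snd C) / (u + v + w)).

(** First barycentric coordinate of the [n]-th center, for [1 <= n <= 10];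
    the value for other [n] is a dummy. *)
Definition center_function (n : nat) (a b c : R) : R :=
  match n with
  | 1%nat => a                                              (* incenter *)
  | 2%nat => 1                                              (* centroid *)
  | 3%nat => a^2 * (a^2 - b^2 - c^2)                        (* circumcenter *)
  | 4%nat => (a^2 + b^2 - c^2) * (a^2 - b^2 + c^2)          (* orthocenter *)
  | 5%nat => c^4 - a^2 * b^2 + b^4 - a^2 * c^2 - 2 * b^2 * c^2
                                                            (* nine-point center *)
  | 6%nat => a^2                                            (* symmedian point *)
  | 7%nat => (a + b - c) * (a - b + c)                      (* Gergonne point *)
  | 8%nat => a - b - c                                      (* Nagel point *)
  | 9%nat => a * (a - b - c)                                (* mittenpunkt *)
  | 10%nat => b + c                                         (* Spieker center *)
  | _ => 0
  end.

Definition center (A B C : point) (n : nat) : point :=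
  let a := pdist B C in
  let b := pdist C A in
  let c := pdist A B in
  barycentric A B C
    (center_function n a b c) (center_function n b c a) (center_function n c a b).

Definition cdist (A B C : point) (i j : nat) : R := pdist (center A B C i) (center A B C j).

(* Main.v *)
Require Import Defs.
From Stdlib Require Import Reals Lra Psatz.
Open Scope R_scope.

(** All distances are measured from the centroid [X_2].  On the Euler line the
    distances to [X_3], [X_4], [X_5] have fixed ratios, as do those to [X_1],
    [X_8], [X_10] on the Nagel line and those to [X_7], [X_9]; so only
    [D(2,1)], [D(2,3)], [D(2,6)], [D(2,7)] have to be compared.  With the Ravi
    substitution [a = y + z], [b = z + x], [c = x + y], the square of each of
    them is a symmetric rational function of [x, y, z > 0], and a comparison
    becomes a symmetric polynomial inequality.  Ordering the variables as
    [x], [x + p], [x + p + q] with [p, q >= 0] makes every coefficient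
    nonnegative, except for the sharp bound
    [D(2,6) <= (4 + 3 sqrt 2) / 4 * D(2,1)], which is attained on an isosceles
    triangle and whose polynomial contains a square accordingly. *)

(** * Distances and their comparison through squares *)

Lemma pdist_nonneg (P Q : point) : 0 <= pdist P Q.
Proof. apply sqrt_pos. Qed.

Lemma pdist_sq (P Q : point) :
  pdist P Q ^ 2 = (fst P - fst Q) ^ 2 + (snd P - snd Q) ^ 2.
Proof.
  unfold pdist, dist_euc. rewrite pow2_sqrt, !Rsqr_pow2; [reflexivity|].
  apply Rplus_le_le_0_compat; apply Rle_0_sqr.
Qed.

Lemma pdist_sym (P Q : point) : pdist P Q = pdist Q P.
Proof. apply distance_symm. Qed.

Lemma pdist_triangle (P Q S : point) : pdist P Q <= pdist P S + pdist S Q.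
Proof. apply triangle. Qed.

Lemma scaled_eq_of_sq (k u v : R) :
  0 <= k -> 0 <= u -> 0 <= v -> v ^ 2 = k ^ 2 * u ^ 2 -> v = k * u.
Proof.
  intros hk hu hv h. assert (0 <= k * u) by now apply Rmult_le_pos. nra.
Qed.

(** The difference [(k * v) ^ 2 - (j * u) ^ 2] is the last hypothesis divided by [b * d]; this turns
    a bound between distances into a polynomial inequality. *)
Lemma scaled_le_of_sq_ratio (j k u v a b c d : R) :
  u ^ 2 = a / b -> v ^ 2 = c / d -> 0 <= k -> 0 <= v -> 0 < b -> 0 < d ->
  0 <= k ^ 2 * c * b - j ^ 2 * a * d -> j * u <= k * v.
Proof.
  intros hu hv2 hk hv hb hd h.
  assert (hkv : 0 <= k * v) by now apply Rmult_le_pos.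
  assert (e : (k * v) ^ 2 - (j * u) ^ 2 = (k ^ 2 * c * b - j ^ 2 * a * d) / (b * d)).
  { rewrite !Rpow_mult_distr, hu, hv2. field. lra. }
  assert (0 <= (k ^ 2 * c * b - j ^ 2 * a * d) / (b * d))
    by (apply Rle_mult_inv_pos; [exact h|now apply Rmult_lt_0_compat]).
  nra.
Qed.

(** The displacement from the centroid has barycentric coordinates
    [(3u - s)/(3s)], ... with [s = u + v + w]; they sum to zero, and a vector
    with such coordinates [(l, m, n)] has squared length
    [- (a^2 m n + b^2 n l + c^2 l m)]. *)
Lemma pdist_centroid_sq (A B C : point) (a b c u v w s : R) :
  pdist B C = a -> pdist C A = b -> pdist A B = c -> u + v + w = s -> s <> 0 ->
  pdist (barycentric A B C 1 1 1) (barycentric A B C u v w) ^ 2 =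
  - (a ^ 2 * (3 * v - s) * (3 * w - s) + b ^ 2 * (3 * w - s) * (3 * u - s)
     + c ^ 2 * (3 * u - s) * (3 * v - s)) / (9 * s ^ 2).
Proof.
  intros <- <- <- <- hs. rewrite !pdist_sq.
  unfold barycentric; simpl fst; simpl snd. field. exact hs.
Qed.

(** * Nondegeneracy and the Ravi substitution *)

Lemma nondegenerate_cross (A B C : point) :
  nondegenerate A B C ->
  (fst B - fst A) * (snd C - snd A) - (snd B - snd A) * (fst C - fst A) <> 0.
Proof.
  intros h hcross. apply h. unfold collinear.
  destruct (Req_dec (fst B) (fst A)) as [h1|h1].
  - destruct (Req_dec (snd B) (snd A)) as [h2|h2].
    + destruct (Req_dec (fst C) (fst A)) as [h3|h3].
      (* Here [A = B]: the line is vertical if [C] has the same abscissa, and otherwise it is the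
         line [AC]. In the remaining cases it is [AB]. *)
      * exists 1, 0, (fst A). repeat split; lra.
      * exists (snd A - snd C), (fst C - fst A),
          ((snd A - snd C) * fst A + (fst C - fst A) * snd A).
        rewrite h1, h2. repeat split; lra.
    + exists (snd A - snd B), (fst B - fst A),
        ((snd A - snd B) * fst A + (fst B - fst A) * snd A).
      repeat split; lra.
  - exists (snd A - snd B), (fst B - fst A),
      ((snd A - snd B) * fst A + (fst B - fst A) * snd A).
    repeat split; lra.
Qed.

(** Heron's formula: both sides are 16 times the squared area. Expanded, the left side contains only
    even powers of the sides, so no square root remains. *)
Lemma heron_cross (A B C : point) (a b c : R) :
  pdist B C = a -> pdist C A = b -> pdist A B = c ->
  (a + b + c) * ((b + c - a) * ((c + a - b) * (a + b - c))) =
  4 * ((fst B - fst A) * (snd C - snd A) - (snd B - snd A) * (fst C - fst A)) ^ 2.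
Proof.
  intros ha hb hc.
  transitivity (2 * (a ^ 2 * b ^ 2 + b ^ 2 * c ^ 2 + c ^ 2 * a ^ 2)
                - ((a ^ 2) ^ 2 + (b ^ 2) ^ 2 + (c ^ 2) ^ 2)); [ring|].
  rewrite <- ha, <- hb, <- hc, !pdist_sq. ring.
Qed.

(** The triangle inequalities make the three Heron factors nonnegative, and a nonzero area keeps
    each of them from vanishing. *)
Lemma ravi (A B C : point) : nondegenerate A B C ->
  exists x y z, 0 < x /\ 0 < y /\ 0 < z /\
    pdist B C = y + z /\ pdist C A = z + x /\ pdist A B = x + y.
Proof.
  intros h.
  pose proof (nondegenerate_cross _ _ _ h) as hx.
  pose proof (heron_cross A B C _ _ _ eq_refl eq_refl eq_refl) as hh.
  pose proof (pdist_triangle B C A) as ta. pose proof (pdist_triangle C A B) as tb.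
  pose proof (pdist_triangle A B C) as tc.
  rewrite (pdist_sym B A), (pdist_sym A C) in ta.
  rewrite (pdist_sym C B), (pdist_sym B A) in tb.
  rewrite (pdist_sym A C), (pdist_sym C B) in tc.
  set (a := pdist B C) in *. set (b := pdist C A) in *. set (c := pdist A B) in *.
  apply (pow_nonzero _ 2) in hx.
  assert (hp : (a + b + c) * ((b + c - a) * ((c + a - b) * (a + b - c))) <> 0)
    by (rewrite hh; lra).
  clearbody a b c. clear hh hx h A B C.
  assert (b + c - a <> 0) by (intros e; apply hp; rewrite e; ring).
  assert (c + a - b <> 0) by (intros e; apply hp; rewrite e; ring).
  assert (a + b - c <> 0) by (intros e; apply hp; rewrite e; ring).
  (* The tangent lengths from the vertices to the incircle. *)
  exists ((b + c - a) / 2), ((c + a - b) / 2), ((a + b - c) / 2).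
  repeat split; lra.
Qed.

(** * Symmetric polynomials in the Ravi variables *)

Ltac nonneg :=
  repeat first [ apply Rplus_le_le_0_compat | apply Rmult_le_pos | apply pow_le
               | assumption | lra ].

(** The two transpositions generate all permutations, so the variables may be sorted. *)
Lemma symmetric_wlog (P : R -> R -> R -> R) :
  (forall x y z, P y x z = P x y z) -> (forall x y z, P x z y = P x y z) ->
  (forall x p q, 0 <= x -> 0 <= p -> 0 <= q -> 0 <= P x (x + p) (x + p + q)) ->
  forall x y z, 0 < x -> 0 < y -> 0 < z -> 0 <= P x y z.
Proof.
  intros h1 h2 h.
  assert (ho : forall x y z, 0 < x -> x <= y -> y <= z -> 0 <= P x y z).
  { intros x y z hx hy hz. specialize (h x (y - x) (z - y)).
    replace (x + (y - x)) with y in h by ring. replace (y + (z - y)) with z in h by ring.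
    apply h; lra. }
  intros x y z hx hy hz.
  destruct (Rle_dec x y), (Rle_dec y z), (Rle_dec x z);
    try (apply ho; lra); try (exfalso; lra).
  - rewrite <- h2. apply ho; lra.
  - rewrite <- h2, <- h1. apply ho; lra.
  - rewrite <- h1. apply ho; lra.
  - rewrite <- h1, <- h2. apply ho; lra.
  - rewrite <- h1, <- h2, <- h1. apply ho; lra.
Qed.

(** In the Ravi variables, [9 * D(2,n)^2] is [num1 / den1], [num3 / den3],
    [num6 / den6 ^ 2], [num7 / den7 ^ 2] for [n = 1, 3, 6, 7]; [den3] is [16]
    times the squared area. *)
Definition num1 (x y z : R) : R :=
  (x + y + z) ^ 3 - 4 * (x + y + z) * (x * y + y * z + z * x) + 9 * (x * y * z).
Definition den1 (x y z : R) : R := x + y + z.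

Definition den3 (x y z : R) : R := 16 * (x + y + z) * (x * y * z).
Definition den6 (x y z : R) : R := (y + z) ^ 2 + (z + x) ^ 2 + (x + y) ^ 2.
(** From [OG^2 = R^2 - (a^2 + b^2 + c^2) / 9] with circumradius [R = abc / (4S)] and area [S];
    [den6] is [a^2 + b^2 + c^2]. *)
Definition num3 (x y z : R) : R :=
  9 * ((y + z) * (z + x) * (x + y)) ^ 2 - den3 x y z * den6 x y z.

Definition num6 (x y z : R) : R :=
  6 * den6 x y z * (((y + z) * (z + x)) ^ 2 + ((z + x) * (x + y)) ^ 2 + ((x + y) * (y + z)) ^ 2)
  - den6 x y z ^ 3 - 27 * ((y + z) * (z + x) * (x + y)) ^ 2.

Definition den7 (x y z : R) : R := x * y + y * z + z * x.
Definition num7 (x y z : R) : R :=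
  ((x + y + z) * den7 x y z) ^ 2 - 4 * den7 x y z ^ 3
  + 6 * (x + y + z) * den7 x y z * (x * y * z) - 27 * (x * y * z) ^ 2.

Ltac unfold_ravi := unfold num1, num3, num6, num7, den1, den3, den6, den7.

Lemma den1_pos (x y z : R) : 0 < x -> 0 < y -> 0 < z -> 0 < den1 x y z.
Proof. unfold den1; lra. Qed.

Lemma den3_pos (x y z : R) : 0 < x -> 0 < y -> 0 < z -> 0 < den3 x y z.
Proof. intros; unfold den3; repeat apply Rmult_lt_0_compat; lra. Qed.

Lemma den6_pos (x y z : R) : 0 < x -> 0 < y -> 0 < z -> 0 < den6 x y z.
Proof. intros; unfold den6; nra. Qed.

Lemma den7_pos (x y z : R) : 0 < x -> 0 < y -> 0 < z -> 0 < den7 x y z.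
Proof. intros; unfold den7; nra. Qed.

(** * The eight polynomial inequalities *)

Ltac by_ordering P :=
  apply (symmetric_wlog P); [intros; unfold_ravi; ring | intros; unfold_ravi; ring |].

Ltac nonneg_coefficients := intros; unfold_ravi; ring_simplify; nonneg.

(** Each [ineq_i_j] is a bound of [D(2,i)] by a multiple of [D(2,j)], squared and cleared of
    denominators; here [D(2,6) <= 2 D(2,3)]. *)
Lemma ineq_6_3 (x y z : R) : 0 < x -> 0 < y -> 0 < z ->
  0 <= 4 * num3 x y z * den6 x y z ^ 2 - num6 x y z * den3 x y z.
Proof.
  by_ordering (fun x y z => 4 * num3 x y z * den6 x y z ^ 2 - num6 x y z * den3 x y z).
  nonneg_coefficients.
Qed.

Lemma ineq_7_3 (x y z : R) : 0 < x -> 0 < y -> 0 < z ->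
  0 <= 4 * num3 x y z * den7 x y z ^ 2 - num7 x y z * den3 x y z.
Proof.
  by_ordering (fun x y z => 4 * num3 x y z * den7 x y z ^ 2 - num7 x y z * den3 x y z).
  nonneg_coefficients.
Qed.

Lemma ineq_1_6 (x y z : R) : 0 < x -> 0 < y -> 0 < z ->
  0 <= num6 x y z * den1 x y z - num1 x y z * den6 x y z ^ 2.
Proof.
  by_ordering (fun x y z => num6 x y z * den1 x y z - num1 x y z * den6 x y z ^ 2).
  nonneg_coefficients.
Qed.

Lemma ineq_1_7 (x y z : R) : 0 < x -> 0 < y -> 0 < z ->
  0 <= num7 x y z * den1 x y z - num1 x y z * den7 x y z ^ 2.
Proof.
  by_ordering (fun x y z => num7 x y z * den1 x y z - num1 x y z * den7 x y z ^ 2).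
  nonneg_coefficients.
Qed.

Lemma ineq_7_1 (x y z : R) : 0 < x -> 0 < y -> 0 < z ->
  0 <= 16 * num1 x y z * den7 x y z ^ 2 - num7 x y z * den1 x y z.
Proof.
  by_ordering (fun x y z => 16 * num1 x y z * den7 x y z ^ 2 - num7 x y z * den1 x y z).
  nonneg_coefficients.
Qed.

Lemma ineq_7_6 (x y z : R) : 0 < x -> 0 < y -> 0 < z ->
  0 <= 4 * num6 x y z * den7 x y z ^ 2 - num7 x y z * den6 x y z ^ 2.
Proof.
  by_ordering (fun x y z => 4 * num6 x y z * den7 x y z ^ 2 - num7 x y z * den6 x y z ^ 2).
  nonneg_coefficients.
Qed.

Lemma ineq_6_7 (x y z : R) : 0 < x -> 0 < y -> 0 < z ->
  0 <= 9 * num7 x y z * den6 x y z ^ 2 - 4 * num6 x y z * den7 x y z ^ 2.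
Proof.
  by_ordering (fun x y z => 9 * num7 x y z * den6 x y z ^ 2 - 4 * num6 x y z * den7 x y z ^ 2).
  nonneg_coefficients.
Qed.

(** The constant is [8 ((4 + 3 sqrt 2) / 4)^2]. Equality holds at [(x, x + m, x + m)] with
    [m = sqrt 2 * x]. *)
Lemma ineq_6_1 (x y z : R) : 0 < x -> 0 < y -> 0 < z ->
  0 <= (17 + 12 * sqrt 2) * num1 x y z * den6 x y z ^ 2 - 8 * num6 x y z * den1 x y z.
Proof.
  by_ordering (fun x y z =>
    (17 + 12 * sqrt 2) * num1 x y z * den6 x y z ^ 2 - 8 * num6 x y z * den1 x y z).
  clear x y z; intros x p q hx hp hq.
  assert (ht : sqrt 2 * sqrt 2 = 2) by (apply sqrt_sqrt; lra).
  assert (ht0 := sqrt_pos 2). set (t := sqrt 2) in *. clearbody t.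
  (* Large enough to make every coefficient linear in [t] below nonnegative. *)
  assert (ht1 : 141 / 100 <= t) by nra.
  (* Centering the two larger variables at their mean makes the polynomial even in [r], by
     symmetry. *)
  set (m := p + q / 2). set (r := q / 2).
  replace (x + p + q) with (x + m + r) by (unfold m, r; field).
  replace (x + p) with (x + m - r) by (unfold m, r; ring).
  assert (hm : 0 <= m) by (unfold m; lra). assert (hr : 0 <= r) by (unfold r; lra).
  clearbody m r. unfold_ravi.
  (* At [r = 0] (isosceles triangles) only the square survives. *)
  match goal with |- 0 <= ?e => replace e with
    (x * m ^ 2 * (2 * x - m * t) ^ 2 *
       ((432 * t - 540) * x ^ 2 + (612 * t - 768) * x * m + (216 * t - 270) * m ^ 2)
     + r ^ 2 *
       ((5184 * t - 6480) * x ^ 5 + (27648 * t - 27648) * x ^ 4 * m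
        + (51840 * t - 40416) * x ^ 3 * m ^ 2 + (1728 * t + 6768) * x ^ 3 * r ^ 2
        + (46080 * t - 25344) * x ^ 2 * m ^ 3 + (6912 * t + 17856) * x ^ 2 * m * r ^ 2
        + (20016 * t - 6300) * x * m ^ 4 + (7056 * t + 15180) * x * m ^ 2 * r ^ 2
        + (144 * t + 108) * x * r ^ 4 + (3456 * t - 288) * m ^ 5
        + (2304 * t + 4416) * m ^ 3 * r ^ 2 + (384 * t + 480) * m * r ^ 4))
    by ring [ht] end.
  repeat first [ lra | apply Rplus_le_le_0_compat | apply pow2_ge_0
               | apply Rmult_le_pos | apply pow_le ].
Qed.

(** * Squared distances from the centroid *)

Lemma cdist_centroid_sq (A B C : point) (n : nat) (x y z s num den : R) :
  pdist B C = y + z -> pdist C A = z + x -> pdist A B = x + y ->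
  let u := center_function n (y + z) (z + x) (x + y) in
  let v := center_function n (z + x) (x + y) (y + z) in
  let w := center_function n (x + y) (y + z) (z + x) in
  u + v + w = s -> s <> 0 -> den <> 0 ->
  - ((y + z) ^ 2 * (3 * v - s) * (3 * w - s) + (z + x) ^ 2 * (3 * w - s) * (3 * u - s)
     + (x + y) ^ 2 * (3 * u - s) * (3 * v - s)) * den = num * (9 * s ^ 2) ->
  cdist A B C 2 n ^ 2 = num / den.
Proof.
  intros ha hb hc u v w hsum hs hden h.
  unfold cdist, center; cbv zeta. rewrite ha, hb, hc. fold u v w.
  cbn [center_function].
  rewrite (pdist_centroid_sq A B C _ _ _ u v w s ha hb hc hsum hs).
  apply (Rmult_eq_reg_r den); [|exact hden].
  apply (Rmult_eq_reg_r (9 * s ^ 2)); [|apply Rmult_integral_contrapositive; split;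
    [lra|now apply pow_nonzero]].
  transitivity (num * (9 * s ^ 2)); [rewrite <- h|]; field; auto.
Qed.

Lemma centroid_cdists_sq (A B C : point) (x y z : R) : 0 < x -> 0 < y -> 0 < z ->
  pdist B C = y + z -> pdist C A = z + x -> pdist A B = x + y ->
  let d n := cdist A B C 2 n ^ 2 in
  (d 1%nat = num1 x y z / (9 * den1 x y z) /\
   d 8%nat = 4 * num1 x y z / (9 * den1 x y z) /\
   d 10%nat = num1 x y z / (36 * den1 x y z)) /\
  (d 3%nat = num3 x y z / (9 * den3 x y z) /\
   d 4%nat = 4 * num3 x y z / (9 * den3 x y z) /\
   d 5%nat = num3 x y z / (36 * den3 x y z)) /\
  d 6%nat = num6 x y z / (9 * den6 x y z ^ 2) /\
  d 7%nat = num7 x y z / (9 * den7 x y z ^ 2) /\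
  d 9%nat = num7 x y z / (36 * den7 x y z ^ 2).
Proof.
  intros hx hy hz ha hb hc.
  pose proof (den1_pos x y z hx hy hz) as h1. pose proof (den3_pos x y z hx hy hz) as h3.
  pose proof (den6_pos x y z hx hy hz) as h6. pose proof (den7_pos x y z hx hy hz) as h7.
  pose proof (pow_lt _ 2 h6) as h6'. pose proof (pow_lt _ 2 h7) as h7'.
  intros d; subst d; cbv beta.
  pose proof (fun n s num den => cdist_centroid_sq A B C n x y z s num den ha hb hc) as h.
  (* The supplied values are the coordinate sums [u + v + w], negative for the centers 8, 3, 5 and
     9. *)
  repeat split;
    [ apply (h _ (2 * den1 x y z)) | apply (h _ (- 2 * den1 x y z))
    | apply (h _ (4 * den1 x y z)) | apply (h _ (- den3 x y z))
    | apply (h _ (den3 x y z)) | apply (h _ (- 2 * den3 x y z))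
    | apply (h _ (den6 x y z)) | apply (h _ (4 * den7 x y z))
    | apply (h _ (- 4 * den7 x y z)) ];
    try lra; unfold center_function; unfold_ravi; ring.
Qed.

(** * Derivation of all the bounds *)

Ltac compare_sq := eapply scaled_le_of_sq_ratio; try eassumption; auto; lra.

Theorem theorem2 (A B C : point) (hABC : nondegenerate A B C) :
  cdist A B C 2 1 <= 2 * cdist A B C 2 3 /\
  cdist A B C 2 1 <= 1 * cdist A B C 2 4 /\
  cdist A B C 2 1 <= 4 * cdist A B C 2 5 /\
  (6 * sqrt 2 - 8) * cdist A B C 2 6 <= cdist A B C 2 1 <= 1 * cdist A B C 2 6 /\
  (1/4) * cdist A B C 2 7 <= cdist A B C 2 1 <= 1 * cdist A B C 2 7 /\
  cdist A B C 2 1 = (1/2) * cdist A B C 2 8 /\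
  (1/2) * cdist A B C 2 9 <= cdist A B C 2 1 <= 2 * cdist A B C 2 9 /\
  cdist A B C 2 1 = 2 * cdist A B C 2 10 /\

  cdist A B C 2 3 = (1/2) * cdist A B C 2 4 /\
  cdist A B C 2 3 = 2 * cdist A B C 2 5 /\
  (1/2) * cdist A B C 2 6 <= cdist A B C 2 3 /\
  (1/2) * cdist A B C 2 7 <= cdist A B C 2 3 /\
  (1/4) * cdist A B C 2 8 <= cdist A B C 2 3 /\
  1 * cdist A B C 2 9 <= cdist A B C 2 3 /\
  1 * cdist A B C 2 10 <= cdist A B C 2 3 /\

  cdist A B C 2 4 = 4 * cdist A B C 2 5 /\
  1 * cdist A B C 2 6 <= cdist A B C 2 4 /\
  1 * cdist A B C 2 7 <= cdist A B C 2 4 /\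
  (1/2) * cdist A B C 2 8 <= cdist A B C 2 4 /\
  2 * cdist A B C 2 9 <= cdist A B C 2 4 /\
  2 * cdist A B C 2 10 <= cdist A B C 2 4 /\

  (1/4) * cdist A B C 2 6 <= cdist A B C 2 5 /\
  (1/4) * cdist A B C 2 7 <= cdist A B C 2 5 /\
  (1/8) * cdist A B C 2 8 <= cdist A B C 2 5 /\
  (1/2) * cdist A B C 2 9 <= cdist A B C 2 5 /\
  (1/2) * cdist A B C 2 10 <= cdist A B C 2 5 /\

  (1/2) * cdist A B C 2 7 <= cdist A B C 2 6 <= (3/2) * cdist A B C 2 7 /\
  (1/2) * cdist A B C 2 8 <= cdist A B C 2 6 <= ((4 + 3 * sqrt 2) / 8) * cdist A B C 2 8 /\
  1 * cdist A B C 2 9 <= cdist A B C 2 6 <= 3 * cdist A B C 2 9 /\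
  2 * cdist A B C 2 10 <= cdist A B C 2 6 <= (2 + 3 / sqrt 2) * cdist A B C 2 10 /\

  (1/2) * cdist A B C 2 8 <= cdist A B C 2 7 <= 2 * cdist A B C 2 8 /\
  cdist A B C 2 7 = 2 * cdist A B C 2 9 /\
  2 * cdist A B C 2 10 <= cdist A B C 2 7 <= 8 * cdist A B C 2 10 /\

  1 * cdist A B C 2 9 <= cdist A B C 2 8 <= 4 * cdist A B C 2 9 /\
  cdist A B C 2 8 = 4 * cdist A B C 2 10 /\

  1 * cdist A B C 2 10 <= cdist A B C 2 9 <= 4 * cdist A B C 2 10.
Proof.
  destruct (ravi A B C hABC) as (x & y & z & hx & hy & hz & ha & hb & hc).
  pose proof (den1_pos x y z hx hy hz) as h1. pose proof (den3_pos x y z hx hy hz) as h3.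
  pose proof (den6_pos x y z hx hy hz) as h6. pose proof (den7_pos x y z hx hy hz) as h7.
  pose proof (ineq_6_3 x y z hx hy hz) as i63. pose proof (ineq_7_3 x y z hx hy hz) as i73.
  pose proof (ineq_1_6 x y z hx hy hz) as i16. pose proof (ineq_6_1 x y z hx hy hz) as i61.
  pose proof (ineq_1_7 x y z hx hy hz) as i17. pose proof (ineq_7_1 x y z hx hy hz) as i71.
  pose proof (ineq_7_6 x y z hx hy hz) as i76. pose proof (ineq_6_7 x y z hx hy hz) as i67.
  destruct (centroid_cdists_sq A B C x y z hx hy hz ha hb hc)
    as ((s1 & s8 & s10) & (s3 & s4 & s5) & s6 & s7 & s9).
  assert (hn : forall n, 0 <= cdist A B C 2 n) by (intros n; apply pdist_nonneg).
  revert hn s1 s3 s4 s5 s6 s7 s8 s9 s10. generalize (cdist A B C 2).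
  intros d hn s1 s3 s4 s5 s6 s7 s8 s9 s10.
  assert (e8 : d 8%nat = 2 * d 1%nat)
    by (apply scaled_eq_of_sq; auto; [lra|rewrite s8, s1; field; lra]).
  assert (e10 : d 10%nat = 1 / 2 * d 1%nat)
    by (apply scaled_eq_of_sq; auto; [lra|rewrite s10, s1; field; lra]).
  assert (e4 : d 4%nat = 2 * d 3%nat)
    by (apply scaled_eq_of_sq; auto; [lra|rewrite s4, s3; field; lra]).
  assert (e5 : d 5%nat = 1 / 2 * d 3%nat)
    by (apply scaled_eq_of_sq; auto; [lra|rewrite s5, s3; field; lra]).
  assert (e9 : d 9%nat = 1 / 2 * d 7%nat)
    by (apply scaled_eq_of_sq; auto; [lra|rewrite s9, s7; field; lra]).
  assert (ht : sqrt 2 * sqrt 2 = 2) by (apply sqrt_sqrt; lra).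
  assert (ht0 : 0 < sqrt 2) by (apply sqrt_lt_R0; lra).
  assert (htd : 3 / sqrt 2 = 3 / 2 * sqrt 2) by (rewrite <- ht at 2; field; lra).
  set (t := sqrt 2) in *. clearbody t.
  (* Gives [0 <= 6 * t - 8]. *)
  assert (ht1 : 4 / 3 <= t) by nra.
  assert (hk : ((4 + 3 * t) / 4) ^ 2 = (17 + 12 * t) / 8) by lra.
  pose proof (pow_lt _ 2 h6) as h6'. pose proof (pow_lt _ 2 h7) as h7'.
  assert (l63 : 1 * d 6%nat <= 2 * d 3%nat) by compare_sq.
  assert (l73 : 1 * d 7%nat <= 2 * d 3%nat) by compare_sq.
  assert (l16 : 1 * d 1%nat <= 1 * d 6%nat) by compare_sq.
  assert (l61 : 1 * d 6%nat <= (4 + 3 * t) / 4 * d 1%nat)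
    by (eapply scaled_le_of_sq_ratio; try eassumption; auto; try rewrite hk; lra).
  assert (l17 : 1 * d 1%nat <= 1 * d 7%nat) by compare_sq.
  assert (l71 : 1 * d 7%nat <= 4 * d 1%nat) by compare_sq.
  assert (l76 : 1 * d 7%nat <= 2 * d 6%nat) by compare_sq.
  assert (l67 : 2 * d 6%nat <= 3 * d 7%nat) by compare_sq.
  (* Since [t * t = 2], the factor [6 * t - 8] is the inverse of [(4 + 3 * t) / 4]. *)
  assert (l61' : (6 * t - 8) * d 6%nat <= d 1%nat).
  { replace (d 1%nat) with ((6 * t - 8) * ((4 + 3 * t) / 4 * d 1%nat)) by (field [ht]).
    apply Rmult_le_compat_l; lra. }
  pose proof (hn 1%nat) as n1. pose proof (hn 3%nat) as n3.
  pose proof (hn 6%nat) as n6. pose proof (hn 7%nat) as n7.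
  (* Only [d 1], [d 3], [d 6], [d 7] remain. Missing comparisons follow by chaining, such as
     [d 1 <= d 6 <= 2 * d 3]. *)
  rewrite htd, e8, e10, e4, e5, e9. repeat split; lra.
Qed.
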